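(* Let $r\ge 3$, let $m_1,\dots,m_r$ be positive integers and $k=\sum_{i=1}^r m_i$. Then $$\binom{k}{m_1,m_2,\dots,m_r}=\sum_{(B_1,B_2)\in\mathcal B''}\binom{k-r+3}{S(B_2)-|B_2|+2}\cdot\binom{S(B_1)}{B_1}\cdot\binom{S(B_2)}{B_2},$$ where $\mathcal B''$ is the set of all pairs $(B_1,B_2)$ such that $X=\{x_1,\dots,x_r\}$ is the disjoint union of $B_1$ and $B_2$, $x_1\in B_1$ and $x_2,x_3\in B_2$.
   Context: $X=\{x_1,\dots,x_r\}$ is a set of $r$ distinct indeterminates. The function $g$ on $X$ is given by $g(x_1)=m_1-1$ and $g(x_i)=m_i$ for $i>1$. For $B\subset X$ put $S(B)=\sum_{x\in B}g(x)$ and $\binom{S(B)}{B}=\dfrac{S(B)!}{\prod_{x\in B}g(x)!}$. $|B|$ is the cardinality of $B$. $\binom{k}{m_1,\dots,m_r}=k!/(m_1!\cdots m_r!)$. *)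

(* Defs.v *)
From mathcomp Require Import all_boot.

Set Implicit Arguments.
Unset Strict Implicit.
Unset Printing Implicit Defensive.

(* The set X = {x_1, ..., x_r} is represented by 'I_r: the indeterminate x_i  *)
(* is the ordinal of value i - 1.                                             *)
Definition x1 (r : nat) (hr : 3 <= r) : 'I_r :=
  Ordinal (leq_trans (isT : 0 < 3) hr).
Definition x2 (r : nat) (hr : 3 <= r) : 'I_r :=
  Ordinal (leq_trans (isT : 1 < 3) hr).
Definition x3 (r : nat) (hr : 3 <= r) : 'I_r :=
  Ordinal (leq_trans (isT : 2 < 3) hr).

Definition g (r : nat) (hr : 3 <= r) (m : 'I_r -> nat) (x : 'I_r) : nat :=
  if x == x1 hr then m x - 1 else m x.

Definition gsum (X : finType) (f : X -> nat) (B : {set X}) : nat :=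
  \sum_(x in B) f x.

(* The division is exact, see multinomialM.                                   *)
Definition multinomial (X : finType) (f : X -> nat) (B : {set X}) : nat :=
  (gsum f B)`! %/ \prod_(x in B) (f x)`!.

Lemma multinomialM (X : finType) (f : X -> nat) (B : {set X}) :
  multinomial f B * \prod_(x in B) (f x)`! = (gsum f B)`!.
Proof.
apply: divnK; rewrite /gsum.
elim/big_rec2: _ => [|x n p _ dvd_pn]; first exact: dvd1n.
rewrite -(@bin_fact (f x + n) (f x)) ?leq_addr// addKn.
by rewrite dvdn_mull// dvdn_mul.
Qed.

Definition calB'' (r : nat) (hr : 3 <= r) : {set {set 'I_r} * {set 'I_r}} :=
  [set B | [&& B.1 :|: B.2 == [set: 'I_r], [disjoint B.1 & B.2],
               x1 hr \in B.1, x2 hr \in B.2 & x3 hr \in B.2]].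

(* Main.v *)
Require Import Defs.
From mathcomp Require Import all_boot.
From mathcomp Require Import zify ring.

Set Implicit Arguments.
Unset Strict Implicit.
Unset Printing Implicit Defensive.

(** Put [Y = X \ {x_1, x_2, x_3}], [n = |Y|], [q = m_1] and [p = m_2 + m_3].
    After clearing factorials and dividing by [(k - n)!], the theorem is the
    Hurwitz-type identity
      [(p + q + S(Y))_n = \sum_(A ⊆ Y) P_A(p) * Q_{Y \ A}(q)]
    with falling factorials [P_A(p) = (p + S(A))_{|A|}] and
    [Q_A(q) = q (q + S(A) - 1)_{|A| - 1}], [Q_∅ = 1].  Both families satisfy
    [F_A(z + 1) - F_A(z) = \sum_(y in A) F_{A \ y}(z + s(y))], so the two sides
    have, by induction on [Y], the same increments in [q]; at [q = 0] only
    [A = Y] contributes. *)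

Definition hurwitzP (X : finType) (s : X -> nat) (p : nat) (A : {set X}) :=
  (p + gsum s A) ^_ #|A|.

(** The value at the empty set follows the convention [(q - 1)_{-1} = 1/q], extended to [q = 0]. *)
Definition hurwitzQ (X : finType) (s : X -> nat) (q : nat) (A : {set X}) :=
  if A == set0 then 1 else q * (q + gsum s A).-1 ^_ #|A|.-1.

Lemma ffactSS_diff (t n : nat) : t.+1 ^_ n.+1 = t ^_ n.+1 + n.+1 * t ^_ n.
Proof.
rewrite ffactSS ffactnSr; case: (leqP n t) => [le_nt|lt_tn].
  have -> : t.+1 = (t - n) + n.+1 by lia.
  by rewrite mulnDl [_ * t ^_ n]mulnC.
by rewrite ffact_small // !muln0.
Qed.

(** Moving [s y] from the set into the argument leaves [p + S(A)] unchanged, so the summands all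
    agree and this is the discrete power rule [ffactSS_diff]. *)
Lemma hurwitzP_diff (X : finType) (s : X -> nat) (p : nat) (A : {set X}) :
  hurwitzP s p.+1 A = hurwitzP s p A + \sum_(y in A) hurwitzP s (p + s y) (A :\ y).
Proof.
have -> : \sum_(y in A) hurwitzP s (p + s y) (A :\ y) =
          #|A| * (p + gsum s A) ^_ #|A|.-1.
  rewrite -sum_nat_const; apply: eq_bigr => y Ay.
  by rewrite /hurwitzP /gsum (big_setD1 y Ay) (cardsD1 y A) Ay addnA.
rewrite /hurwitzP; case: #|A| => [|n]; first by rewrite !ffactn0.
by rewrite addSn ffactSS_diff.
Qed.

Lemma hurwitzQ_diff (X : finType) (s : X -> nat) (q : nat) (A : {set X}) :
  hurwitzQ s q.+1 A = hurwitzQ s q A + \sum_(y in A) hurwitzQ s (q + s y) (A :\ y).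
Proof.
have [->|A0] := eqVneq A set0; first by rewrite /hurwitzQ eqxx big_set0.
(* Singletons are separate because there [A :\ y] is empty and takes the exceptional value 1. *)
have [/cards1P[x ->]|A1] := boolP (#|A| == 1).
  have x0 : [set x] != set0 by rewrite -card_gt0 cards1.
  rewrite big_set1 setDv /hurwitzQ (negbTE x0) eqxx cards1 !ffactn0; lia.
(* All summands share one falling factorial; only the prefactors [q + s y] vary, and they add up to
   [|A| q + S(A)]. *)
have -> : \sum_(y in A) hurwitzQ s (q + s y) (A :\ y) =
          (#|A| * q + gsum s A) * (q + gsum s A).-1 ^_ #|A|.-2.
  rewrite -sum_nat_const /gsum -big_split big_distrl /=.
  apply: eq_bigr => y Ay; rewrite /hurwitzQ ifF.
    by rewrite /gsum [in RHS](big_setD1 y Ay) (cardsD1 y A) Ay addnA.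
  by apply/negbTE; move: A1; rewrite -cards_eq0 (cardsD1 y A) Ay.
rewrite /hurwitzQ (negbTE A0); move: A0 A1; rewrite -cards_eq0.
case: #|A| => [|[|n]] // _ _; rewrite addSn /=.
case E: (q + gsum s A) => [|t] /=.
  have [-> ->] : q = 0 /\ gsum s A = 0 by lia.
  by rewrite ffact0n muln0.
rewrite ffactSS ffactnSr.
case: (leqP n t) => [le_nt|lt_tn]; last by rewrite (ffact_small lt_tn) !muln0.
have -> : gsum s A = t.+1 - q by lia.
have le_q : q <= t.+1 by lia.
(* With [d = t - n] and, below, [e = S(A)], what remains after factoring out [f] is free of
   subtraction. *)
have [d td] : exists d, t = n + d by exists (t - n); lia.
move: le_q; rewrite {}td {E le_nt} => le_q.
rewrite addKn; move: (_ ^_ n) => f.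
have [e e_q] : exists e, (n + d).+1 = q + e by exists ((n + d).+1 - q); lia.
rewrite e_q addKn [q.+1 * _]mulnA.
have -> : q.+1 * (q + e) = q * d + (n.+2 * q + e) by rewrite mulSn -e_q; nia.
ring.
Qed.

Lemma hurwitz_identity (X : finType) (s : X -> nat) (p q : nat) (A : {set X}) :
  hurwitzP s (p + q) A =
  \sum_(B in powerset A) hurwitzP s p B * hurwitzQ s q (A :\: B).
Proof.
(* The hypothesis must hold for every [q]: it is applied to [A :\ y] at [q + s y]. *)
have [n le_An] := ubnP #|A|; elim: n A q le_An => // n IHn A q le_An.
elim: q => [|q IHq].
  rewrite addn0 (big_setD1 A) ?powersetE //= setDv {1}/hurwitzQ eqxx muln1.
  rewrite big1 ?addn0 // => B; rewrite !inE => /andP[neqBA sBA].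
  rewrite /hurwitzQ ifF ?mul0n ?muln0 //; apply: contraNF neqBA.
  by rewrite setD_eq0 eqEsubset sBA.
rewrite addnS hurwitzP_diff IHq.
under [in RHS]eq_bigr => B _ do rewrite hurwitzQ_diff mulnDr big_distrr.
rewrite big_split /=; congr addn.
(* Choosing [B] and then [y] in [A :\: B] amounts to choosing [y] in [A] and then a subset [B] of
   [A :\ y]. *)
rewrite (exchange_big_dep (mem A)) /=; last by move=> B y _ /setDP[].
apply: eq_bigr => y Ay; rewrite -addnA IHn; last first.
  by move: le_An; rewrite (cardsD1 y A) Ay.
apply: eq_big => [B|B _]; first by rewrite !inE Ay subsetD1 andbT andbC.
by rewrite !setDDl setUC.
Qed.

Lemma hurwitzP_fact (X : finType) (s : X -> nat) (p : nat) (A : {set X}) :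
  #|A| <= gsum s A ->
  hurwitzP s p A * (p + gsum s A - #|A|)`! = (p + gsum s A)`!.
Proof. by move=> leA; apply: ffact_fact; lia. Qed.

Lemma hurwitzQ_fact (X : finType) (s : X -> nat) (q : nat) (A : {set X}) :
  #|A| <= gsum s A -> 0 < q ->
  hurwitzQ s q A * (q + gsum s A - #|A|)`! = q * (q + gsum s A).-1`!.
Proof.
move=> leA q_gt0; rewrite /hurwitzQ; have [->|A0] := eqVneq A set0.
  by case: q q_gt0 => // q _; rewrite /gsum big_set0 cards0 subn0 addn0 mul1n.
rewrite -mulnA; congr muln; move: A0; rewrite -card_gt0 => A0.
have -> : q + gsum s A - #|A| = (q + gsum s A).-1 - #|A|.-1 by lia.
by apply: ffact_fact; lia.
Qed.

Lemma card_le_gsum (X : finType) (f : X -> nat) (A : {set X}) :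
  {in A, forall x, 0 < f x} -> #|A| <= gsum f A.
Proof. by move=> f_gt0; rewrite -sum1_card; apply: leq_sum. Qed.

Lemma gsumU1 (X : finType) (f : X -> nat) (x : X) (A : {set X}) :
  x \notin A -> gsum f (x |: A) = f x + gsum f A.
Proof. by move=> xA; rewrite /gsum big_setU1. Qed.

Lemma gsum_setID (X : finType) (f : X -> nat) (A B : {set X}) :
  B \subset A -> gsum f A = gsum f B + gsum f (A :\: B).
Proof. by move=> sBA; rewrite /gsum (big_setID B) (setIidPr sBA). Qed.

(** A pair is determined by the trace [A] of [B_2] on [Y], and every subset of [Y] occurs as a
    trace. *)
Lemma big_calB'' (r : nat) (hr : 3 <= r) (F : {set 'I_r} * {set 'I_r} -> nat)
    (Y := ~: [set x1 hr; x2 hr; x3 hr]) :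
  \sum_(B in calB'' hr) F B =
  \sum_(A in powerset Y) F (x1 hr |: Y :\: A, x2 hr |: (x3 hr |: A)).
Proof.
pose h (A : {set 'I_r}) := (x1 hr |: Y :\: A, x2 hr |: (x3 hr |: A)).
have x12 : (x1 hr == x2 hr) = false by [].
have x13 : (x1 hr == x3 hr) = false by [].
rewrite (reindex_onto h (fun B => B.2 :&: Y)) /=; last first.
  move=> [B1 B2]; rewrite inE /= => /and5P[/eqP U12 D12 B1x B2x B3x].
  have B1E x : (x \in B1) = (x \notin B2).
    have := in_setT x; rewrite -U12 inE.
    by case: (boolP (x \in B1)) => [/(disjointFr D12)->|_ /= ->].
  congr pair; apply/setP=> x; rewrite !inE.
    rewrite B1E; have [->|nx1] := eqVneq x (x1 hr); first by rewrite -B1E B1x.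
    have [->|nx2] := eqVneq x (x2 hr); first by rewrite B2x.
    have [->|nx3] := eqVneq x (x3 hr); first by rewrite B3x.
    by rewrite /= !andbT.
  have [->|nx2] := eqVneq x (x2 hr); first by rewrite B2x.
  have [->|nx3] := eqVneq x (x3 hr); first by rewrite B3x.
  have [->|nx1] /= := eqVneq x (x1 hr); last by rewrite !andbT.
  by rewrite andbF; apply/esym/negbTE; rewrite -B1E.
apply: eq_bigl => A; rewrite powersetE inE /=; apply/andP/idP.
  case=> _ /eqP <-; apply: subsetIr.
move=> sAY; have AY x : x \in A -> x \in Y by apply: subsetP.
have nA x : x \notin Y -> x \notin A by apply: contra; apply: AY.
have nA1 : x1 hr \notin A by apply: nA; rewrite !inE eqxx.
have nA2 : x2 hr \notin A by apply: nA; rewrite !inE eqxx orbT.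
have nA3 : x3 hr \notin A by apply: nA; rewrite !inE eqxx orbT.
split.
  rewrite inE /= !inE !eqxx ?orbT ?andbT /= ?orbT ?andbT; apply/andP; split.
    apply/eqP/setP=> x; rewrite !inE.
    by case: (x == x1 hr); case: (x == x2 hr); case: (x == x3 hr); case: (x \in A).
  apply/pred0P=> x; rewrite /= !inE.
  have [->|nx1] := eqVneq x (x1 hr); first by rewrite x12 x13 (negbTE nA1).
  by case: (x == x2 hr); case: (x == x3 hr); case: (x \in A).
apply/eqP/setP=> x; rewrite !inE.
have [->|nx1] := eqVneq x (x1 hr); first by rewrite (negbTE nA1) andbF.
have [->|nx2] := eqVneq x (x2 hr); first by rewrite (negbTE nA2) andbF.
have [->|nx3] := eqVneq x (x3 hr); first by rewrite (negbTE nA3) andbF.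
by rewrite /= andbT.
Qed.

(* The truncated subtractions never truncate: r <= k, since all m i are       *)
(* positive, and #|B.2| <= gsum (g hr m) B.2, since x_1 is not in B.2.           *)
Theorem mainTheorem4 (r : nat) (hr : 3 <= r) (m : 'I_r -> nat)
    (hm : forall i : 'I_r, 0 < m i) (k : nat) (hk : k = \sum_(i < r) m i) :
  k`! %/ \prod_(i < r) (m i)`! =
  \sum_(B in calB'' hr)
     'C(k - r + 3, gsum (g hr m) B.2 - #|B.2| + 2)
     * multinomial (g hr m) B.1 * multinomial (g hr m) B.2.
Proof.
set G := g hr m; set Y := ~: [set x1 hr; x2 hr; x3 hr].
have x1Y : x1 hr \notin Y by rewrite !inE eqxx.
have x2Y : x2 hr \notin Y by rewrite !inE eqxx orbT.
have x3Y : x3 hr \notin Y by rewrite !inE eqxx orbT.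
have GY (A : {set _}) : A \subset Y -> #|A| <= gsum G A.
  move=> /subsetP sAY; apply: card_le_gsum => x /sAY; rewrite !inE /G /g.
  by case: (x == x1 hr).
have G1 : (G (x1 hr)).+1 = m (x1 hr).
  by rewrite /G /g eqxx subn1 prednK.
have x2x3Y : x2 hr \notin x3 hr |: Y by rewrite in_setU1 negb_or x2Y andbT.
have x1B (A : {set _}) : A \subset Y -> x1 hr \notin x2 hr |: (x3 hr |: A).
  move=> /subsetP sAY; rewrite !inE /=; apply: contra x1Y.
  by move/sAY.
have XE : [set: 'I_r] = x1 hr |: (x2 hr |: (x3 hr |: Y)).
  apply/setP=> x; rewrite !inE.
  by case: (x == x1 hr); case: (x == x2 hr); case: (x == x3 hr).
set p := G (x2 hr) + G (x3 hr); set q := m (x1 hr).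
(* Only [x_1] has its value lowered by [g], and [m_1! = m_1 (m_1 - 1)!]. *)
have prodG : \prod_(i < r) (m i)`! = q * \prod_(i in [set: 'I_r]) (G i)`!.
  rewrite (bigD1 (x1 hr)) //= [in RHS](big_setD1 (x1 hr)) ?inE //= mulnA.
  congr muln; first by rewrite /q -G1 factS.
  by apply: eq_big => [x|x]; rewrite ?inE ?andbT // /G /g => /negbTE ->.
have kE : k = p + q + gsum G Y.
  rewrite hk (bigD1 (x1 hr)) //= -/q.
  have -> : \sum_(i < r | i != x1 hr) m i = gsum G (x2 hr |: (x3 hr |: Y)).
    apply: eq_big => [x|x].
      have := in_setT x; rewrite XE in_setU1; case: eqVneq => [->|_] //= _.
      by rewrite (negbTE (x1B _ _)).
    by rewrite /G /g => /negbTE ->.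
  by rewrite !gsumU1 // /p; lia.
have rE : r = 3 + #|Y|.
  by rewrite -[LHS]card_ord -cardsT XE !cardsU1 x3Y x2x3Y x1B.
have p2 : 2 <= p by rewrite /p /G /g /=; have := hm (x2 hr); have := hm (x3 hr); lia.
have q0 : 0 < q by apply: hm.
have leY := GY Y (subxx Y).
set N := k - r + 3; have NE : N = p + q + gsum G Y - #|Y| by rewrite /N; lia.
suff sumE : (\sum_(B in calB'' hr)
     'C(N, gsum G B.2 - #|B.2| + 2) * multinomial G B.1 * multinomial G B.2)
     * \prod_(i < r) (m i)`! = k`!.
  by rewrite -sumE mulnK // prodn_gt0 // => i; apply: fact_gt0.
rewrite big_calB'' big_distrl /= -/Y.
(* Since [N = k - |Y|], the Hurwitz identity turns this sum into [P_Y(p + q) (k - |Y|)! = k!]. *)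
transitivity (\sum_(A in powerset Y)
   hurwitzP G p A * hurwitzQ G q (Y :\: A) * N`!); last first.
  by rewrite -big_distrl -hurwitz_identity /= NE hurwitzP_fact // kE.
apply: eq_bigr => A; rewrite powersetE => sAY.
have sDY : Y :\: A \subset Y by apply: subsetDl.
have nA x : x \notin Y -> x \notin A by apply: contra; apply: (subsetP sAY).
have nD x : x \notin Y -> x \notin Y :\: A by apply: contra; apply: (subsetP sDY).
have x2x3A : x2 hr \notin x3 hr |: A by rewrite in_setU1 negb_or nA.
set B1 := x1 hr |: _; set B2 := x2 hr |: _.
have S1 : gsum G B1 = (q + gsum G (Y :\: A)).-1 by rewrite gsumU1 ?nD // /q -G1.
have S2 : gsum G B2 = p + gsum G A by rewrite !gsumU1 ?nA // addnA.
have c2 : #|B2| = #|A|.+2 by rewrite !cardsU1 nA // x2x3A.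
have leA := GY A sAY; have leD := GY _ sDY.
have SY : gsum G Y = gsum G A + gsum G (Y :\: A) by apply: gsum_setID.
have cY : #|Y| = #|A| + #|Y :\: A|.
  by rewrite -(cardsID A Y) (setIidPr sAY).
(* The [+ 2] compensates for [x_2] and [x_3] in [|B_2|]; as [2 <= p], nothing is truncated. *)
have -> : gsum G B2 - #|B2| + 2 = p + gsum G A - #|A| by rewrite S2 c2; lia.
have prodB : \prod_(i in [set: 'I_r]) (G i)`! =
    (\prod_(i in B1) (G i)`!) * \prod_(i in B2) (G i)`!.
  rewrite -bigU /=; last first.
    rewrite disjoints_subset; apply/subsetP=> x; rewrite !inE.
    case/orP=> [/eqP->|]; first by have := x1B _ sAY; rewrite !inE.
    by case: (x \in A); case: (x == x2 hr); case: (x == x3 hr); rewrite ?orbT.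
  apply: eq_bigl => x; rewrite !inE.
  by case: (x == x1 hr); case: (x == x2 hr); case: (x == x3 hr); case: (x \in A).
have M1 := multinomialM G B1; have M2 := multinomialM G B2.
rewrite S1 in M1; rewrite S2 -hurwitzP_fact // in M2.
have Q1 := hurwitzQ_fact leD q0.
have leN : p + gsum G A - #|A| <= N by lia.
have bN := bin_fact leN.
(* Of the two factorials that the binomial coefficient contributes to [N!], one completes [P_A(p)]
   to [S(B_2)!] and the other completes [Q_{Y \ A}(q)] to [q S(B_1)!]. *)
have NuE : N - (p + gsum G A - #|A|) = q + gsum G (Y :\: A) - #|Y :\: A| by lia.
rewrite NuE in bN.
rewrite prodG prodB -bN [RHS]mulnC.
transitivity ('C(N, p + gsum G A - #|A|) * (q * (multinomial G B1 * \prod_(i in B1) (G i)`!))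
   * (multinomial G B2 * \prod_(i in B2) (G i)`!)); first by ring.
rewrite M1 M2 -Q1; ring.
Qed.
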